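(* Let $\mathbf{k}$ be a field, let $f\in \mathbf{k}[x_1,\ldots,x_n]$ be a homogeneous cubic polynomial, and let $r=\operatorname{rk}(f)$ be its slice rank. Let $L_f$ be the sum of all $r$-dimensional subspaces $P$ of linear forms such that $f\in (P)$. Then $$\dim L_f\le r^2+\frac{(r+1)^2}{4}+r.$$
   Context: Let $\mathbf{k}$ be an arbitrary field. A linear form is a homogeneous polynomial of degree $1$ (or zero) in $\mathbf{k}[x_1,\ldots,x_n]$; a subspace of linear forms is a $\mathbf{k}$-linear subspace of the space of linear forms. For a subspace of linear forms $P$, $(P)$ denotes the ideal of $\mathbf{k}[x_1,\ldots,x_n]$ generated by $P$. For a homogeneous cubic polynomial $f$, the slice rank $\operatorname{rk}(f)$ is the minimal number $r$ such that $f$ belongs to the ideal $(\ell_1,\ldots,\ell_r)$ generated by $r$ linear forms (equivalently, the minimal codimension in $\mathbb{A}^n$ of a linear subspace contained in the hypersurface $f=0$). Let $\mathcal{P}_f$ denote the set of all subspaces of linear forms $P$ with $\dim P=\operatorname{rk}(f)$ and $f\in (P)$, and set $L_f:=\sum_{P\in\mathcal{P}_f}P$. (Thus $\dim L_f$ is the codimension in $\mathbb{A}^n$ of the intersection of all linear subspaces of minimal codimension contained in the hypersurface $f=0$.) *)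

(* Defs.v *)
From HB Require Import structures.
From mathcomp Require Import all_boot all_order all_algebra.
From mathcomp Require Import boolp.
From mathcomp Require Import mpoly.

Set Implicit Arguments.
Unset Strict Implicit.
Unset Printing Implicit Defensive.

Import Order.TTheory GRing.Theory Num.Theory.
Local Open Scope ring_scope.

(* [dhomog n k 1] consists of the homogeneous polynomials of degree 1 together
   with 0. It is aliased because the library makes [dhomog m k d] a
   finite-dimensional vector space only for m of the form n.+1, whereas here
   the number of variables is arbitrary. *)
Definition linform (k : fieldType) (n : nat) : Type := dhomog n k 1.

HB.instance Definition _ (k : fieldType) (n : nat) :=
  GRing.Lmodule.on (linform k n).

Fact mpolyX_homog (k : fieldType) (n : nat) (i : 'I_n) :
  ('X_i : {mpoly k[n]}) \is 1.-homog.
Proof. by rewrite dhomogX; apply/eqP/mdeg1. Qed.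

Fact linform_vecaxiom (k : fieldType) (n : nat) :
  Vector.axiom n (linform k n).
Proof.
pose c (p : linform k n) : 'rV[k]_n := \row_i (p : {mpoly k[n]})@_(U_(i)%MM).
have cE (v : 'rV[k]_n) i :
    (\sum_(j < n) v 0 j *: ('X_j : {mpoly k[n]}))@_(U_(i)%MM) = v 0 i.
  rewrite raddf_sum /= (bigD1 i) //= big1 => [|j ji].
    by rewrite mcoeffZ mcoeffX eqxx mulr1 addr0.
  by rewrite mcoeffZ mcoeffX eq_mnm1 (negPf ji) mulr0.
have H (v : 'rV[k]_n) : \sum_(i < n) v 0 i *: ('X_i : {mpoly k[n]}) \is 1.-homog.
  by apply: rpred_sum => i _; apply: rpredZ; apply: mpolyX_homog.
exists c; first by move=> a p q; apply/rowP=> i; rewrite !mxE mcoeffD mcoeffZ.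
exists (fun v => DHomog (H v)).
  move=> p; apply/val_inj/mpolyP=> m /=.
  case: (eqVneq (mdeg m) 1%N) => [/eqP m1|mN1]; last first.
    by rewrite !(dhomog_nemf_coeff _ mN1) //; exact: dhomog_is_dhomog.
  by have /mdeg1P[i /eqP ->] := m1; rewrite cE mxE.
by move=> v; apply/rowP=> i; rewrite mxE /= cE.
Qed.

HB.instance Definition _ (k : fieldType) (n : nat) :=
  Lmodule_hasFinDim.Build k (linform k n) (linform_vecaxiom k n).

Definition ideal_gen (R : comNzRingType) (S : R -> Prop) (f : R) : Prop :=
  exists s : seq (R * R),
    (forall q, q \in s -> S q.2) /\ f = \sum_(q <- s) q.1 * q.2.

Definition in_ideal_of_forms (k : fieldType) (n r : nat)
    (l : 'I_r -> linform k n) (f : {mpoly k[n]}) : Prop :=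
  ideal_gen (fun p : {mpoly k[n]} => exists i, p = l i) f.

Definition in_ideal_of_space (k : fieldType) (n : nat)
    (P : {vspace linform k n}) (f : {mpoly k[n]}) : Prop :=
  ideal_gen (fun p : {mpoly k[n]} => exists2 l : linform k n, l \in P & p = l) f.

Fact slice_rank_ex (k : fieldType) (n : nat) (f : dhomog n k 3) :
  exists r, `[< exists l : 'I_r -> linform k n, in_ideal_of_forms l f >].
Proof.
exists n; apply/asboolP; exists (fun i => DHomog (mpolyX_homog k i)).
rewrite /in_ideal_of_forms [X in ideal_gen _ X](mpolyE f) big_seq.
apply: (big_ind (fun g => ideal_gen _ g)) => [|g h [s [sP ->]] [t [tP ->]]|m mf].
- by exists [::]; rewrite big_nil.
- exists (s ++ t); rewrite big_cat; split=> // q.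
  by rewrite mem_cat => /orP[/sP|/tP].
have m3 : mdeg m = 3%N by apply: (dhomog_mf (dhomog_is_dhomog f)).
have [i mi] : exists i, m i != 0%N.
  apply/existsP; apply/contraT; rewrite negb_exists => /forallP m0.
  move: m3; rewrite mdegE big1 // => i _.
  by have := m0 i; rewrite negbK => /eqP.
exists [:: ((f : {mpoly k[n]})@_m *: 'X_[m - U_(i)], 'X_i)].
rewrite big_seq1; split=> [q|/=].
  by rewrite inE => /eqP ->; exists i.
rewrite -scalerAl -mpolyXD submK //; apply/mnm_lepP => j.
by rewrite mnm1E; case: eqP => // <-; rewrite lt0n.
Qed.

Definition slice_rank (k : fieldType) (n : nat) (f : dhomog n k 3) : nat :=
  ex_minn (slice_rank_ex f).

Definition in_sum_of_spaces (k : fieldType) (V : vectType k)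
    (F : {vspace V} -> Prop) (v : V) : Prop :=
  exists s : seq V,
    (forall x, x \in s -> exists2 P, F P & x \in P) /\ v = \sum_(x <- s) x.

Fact sum_of_spaces_ex (k : fieldType) (V : vectType k)
    (F : {vspace V} -> Prop) :
  exists L : {vspace V}, forall v, v \in L <-> in_sum_of_spaces F v.
Proof.
pose U (s : seq V) := forall x, x \in s -> exists2 P, F P & x \in P.
have exd : exists d, `[< exists2 s, U s & \dim <<s>> = d >].
  by exists (\dim <<[::] : seq V>>); apply/asboolP; exists [::].
have bd d : `[< exists2 s, U s & \dim <<s>> = d >] -> (d <= \dim (fullv : {vspace V}))%N.
  by move=> /asboolP[s _ <-]; apply/dimvS/subvf.
case: (ex_maxnP exd bd) => d /asboolP[s Us sd] dmax.
exists <<s>>%VS => v; split=> [vs|[t [Ut ->]]].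
  rewrite (coord_span (X := in_tuple s) vs).
  exists [seq coord (in_tuple s) i v *: (in_tuple s)`_i | i <- enum 'I_(size s)].
  rewrite big_map big_enum; split=> // x /mapP[i _ ->].
  have [P FP sP] : exists2 P, F P & s`_i \in P by apply/Us/mem_nth.
  by exists P => //; apply: rpredZ.
rewrite big_seq; apply: rpred_sum => x /Ut[P FP xP].
have sxs : (<<s>> <= <<x :: s>>)%VS by rewrite span_cons addvSr.
have Uxs : U (x :: s) by move=> y; rewrite inE => /orP[/eqP ->|/Us //]; exists P.
have le : (\dim <<x :: s>> <= \dim <<s>>)%N.
  by rewrite sd; apply: dmax; apply/asboolP; exists (x :: s).
have /eqP -> : <<s>>%VS == <<x :: s>>%VS by rewrite eqEdim sxs.
by apply: memv_span; rewrite mem_head.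
Qed.

(* The family F may be infinite: its sum is the subspace of all finite sums of
   vectors each lying in some member of F. *)
Definition sum_of_spaces (k : fieldType) (V : vectType k)
    (F : {vspace V} -> Prop) : {vspace V} :=
  sval (cid (sum_of_spaces_ex F)).

Definition minimal_space (k : fieldType) (n : nat) (f : dhomog n k 3)
    (P : {vspace linform k n}) : Prop :=
  \dim P = slice_rank f /\ in_ideal_of_space P f.

Definition Lf (k : fieldType) (n : nat) (f : dhomog n k 3) :
    {vspace linform k n} :=
  sum_of_spaces (minimal_space f).

(* Main.v *)
From HB Require Import structures.
Require Import Defs.
From mathcomp Require Import all_boot all_order all_algebra.
From mathcomp Require Import boolp.
From mathcomp Require Import mpoly.
From mathcomp Require Import zify lra.
Import Order.TTheory GRing.Theory Num.Theory.
Local Open Scope ring_scope.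
Set Implicit Arguments.
Unset Strict Implicit.
Unset Printing Implicit Defensive.

(** Write V for the space of linear forms, r for the slice rank of f, and (A) for
    the ideal generated by a subspace A of V.

    Say that f depends on E modulo (A) if f is congruent, modulo (A), to a
    polynomial in the linear forms of E.  If A lies in E and in a minimal space
    P, then P lies in E: otherwise a linear retraction of V that fixes E and
    kills some nonzero p in P would carry P to a space of dimension less than
    r whose ideal still contains f ([minimal_space_sub]).  So it suffices to
    find a small E on which f depends modulo (K), where K is the intersection
    of all minimal spaces; this E contains L_f.

    Such an E is built by intersecting minimal spaces one at a time.  Fix a
    minimal P_0; f depends on P_0 modulo (P_0) since f lies in (P_0).  Suppose f
    depends on E modulo (A) with A inside E, and let B be minimal.  Let h be
    the difference between f and its image under a projection of V onto E + B.
    Then h lies in both (A) and (B), and a cubic in (A) and (B) is, modulo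
    (A :&: B), a sum of terms x_i * y_j * t_ij with x_i in a basis of a
    complement of A :&: B in A, with y_j in a basis of B, and with t_ij linear
    ([cubic_ideal_cap]).  Hence f depends, modulo (A :&: B), on E + B enlarged by
    the t_ij, of which there are (dim A - dim (A :&: B)) * r
    ([depends_mod_cap]).  The numbers of t_ij add up to at most r^2 over the
    whole process, because the differences of dimensions telescope.

    Let m be the least number of minimal spaces whose intersection with P_0 is
    K.  Each of these spaces meets P_0 in dimension at least m - 1: inside
    P_0 :&: Q a strictly decreasing chain of intersections that reaches K has
    at most dim (P_0 :&: Q) steps ([minimal_spaces_cap]).  So adding B to E costs
    at most r - (m - 1) dimensions each time, and
    dim E <= r + m (r + 1 - m) + r^2.  The middle term is at most
    (r + 1)^2 / 4. *)

(** * Linear algebra *)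

(** The displacement [v - pi v] has to stay in B for every v, also outside
    A + B, which rules out projections onto A; the identity minus a projection
    onto B has this property. *)
Lemma retraction_along (k : fieldType) (V : vectType k) (A B : {vspace V}) :
    (A :&: B = 0)%VS ->
  exists pi : 'End(V), [/\ forall v, v \in A -> pi v = v,
    forall v, v \in B -> pi v = 0 & forall v, v - pi v \in B].
Proof.
move=> AB0; have BA0 : (B :&: A = 0)%VS by rewrite capvC.
exists (\1 - daddv_pi B A)%VF; split=> v.
- move=> vA; rewrite add_lfunE opp_lfunE id_lfunE.
  have := daddv_pi_add BA0 (subvP (addvSr B A) v vA).
  by rewrite (daddv_pi_id AB0 vA) => /(canRL (addrK _)) ->; rewrite subrr subr0.
- by move=> vB; rewrite add_lfunE opp_lfunE id_lfunE daddv_pi_id // subrr.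
- by rewrite add_lfunE opp_lfunE id_lfunE opprB addrC subrK memv_pi.
Qed.

(** Only the spaces B that strictly shrink the running intersection are needed,
    and each of those lowers the dimension. *)
Lemma shorten_cap (k : fieldType) (V : vectType k) (A : {vspace V})
    (s : seq {vspace V}) :
  exists s', [/\ {subset s' <= s},
    (A :&: \bigcap_(B <- s') B = A :&: \bigcap_(B <- s) B)%VS &
    (size s' <= \dim A)%N].
Proof.
suff [s' [ss' sE le]] : exists s', [/\ {subset s' <= s},
    (A :&: \bigcap_(B <- s') B = A :&: \bigcap_(B <- s) B)%VS &
    (size s' + \dim (A :&: \bigcap_(B <- s) B) <= \dim A)%N].
  by exists s'; split=> //; apply: leq_trans le; apply: leq_addr.
elim: s A => [|B s IH] A.
  by exists [::]; split=> //; rewrite add0n dimvS ?capvSl.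
rewrite big_cons capvA; have [AB|AB] := boolP (A <= B)%VS.
  have [s' [ss' sE le]] := IH A; exists s'.
  by rewrite (capv_idPl AB); split=> // x /ss' xs; rewrite inE xs orbT.
have [s' [ss' sE le]] := IH (A :&: B)%VS.
exists (B :: s'); split=> [x||]; last 2 first.
- by rewrite big_cons capvA.
- rewrite addSn; apply: leq_ltn_trans le _.
  rewrite ltn_neqAle dimvS ?capvSl // andbT; apply: contraNneq AB => dAB.
  have /eqP <- : (A :&: B == A)%VS by rewrite eqEdim capvSl dAB leqnn.
  exact: capvSr.
- by rewrite !inE => /orP[->//|/ss' ->]; rewrite orbT.
Qed.

(** * Substitutions and ideals of linear forms *)

Section Substitution.
Variables (k : fieldType) (n : nat).
Implicit Types (l : linform k n) (p q f g : {mpoly k[n]}).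
Implicit Types (A B E P : {vspace linform k n}).
Implicit Types phi psi : 'End(linform k n).

(** The inclusion of [linform] into the polynomial ring, named so that it can be
    declared linear. *)
Definition form_val l : {mpoly k[n]} := val l.

Lemma form_val_is_linear : linear form_val.
Proof. by []. Qed.

HB.instance Definition _ :=
  GRing.isLinear.Build k (linform k n) {mpoly k[n]} _ form_val form_val_is_linear.

Definition var (i : 'I_n) : linform k n := DHomog (mpolyX_homog k i).

(** The ring endomorphism extending the linear map [phi] of the degree one part. *)
Definition subst phi p : {mpoly k[n]} :=
  p \mPo [tuple form_val (phi (var i)) | i < n].

Lemma subst_is_linear phi : linear (subst phi).
Proof. exact: linearP. Qed.

Lemma subst_is_multiplicative phi : multiplicative (subst phi).
Proof. exact: comp_mpoly_is_multiplicative. Qed.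

HB.instance Definition _ phi :=
  GRing.isLinear.Build k {mpoly k[n]} {mpoly k[n]} _ (subst phi)
    (subst_is_linear phi).
HB.instance Definition _ phi :=
  GRing.isMultiplicative.Build {mpoly k[n]} {mpoly k[n]} (subst phi)
    (subst_is_multiplicative phi).

Lemma linform_expand l : l = \sum_i (form_val l)@_U_(i) *: var i.
Proof.
apply/val_inj/mpolyP=> m; rewrite -/(form_val l) -/(form_val _) linear_sum /=.
case: (eqVneq (mdeg m) 1%N) => [/eqP m1|mN1]; last first.
  rewrite !(dhomog_nemf_coeff _ mN1) //; last exact: dhomog_is_dhomog.
  by apply: rpred_sum => i _; exact: dhomog_is_dhomog.
have /mdeg1P[i /eqP ->] := m1.
rewrite raddf_sum (bigD1 i) //= big1 => [|j ji].
  by rewrite mcoeffZ mcoeffX eqxx mulr1 addr0.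
by rewrite mcoeffZ mcoeffX eq_mnm1 (negPf ji) mulr0.
Qed.

Lemma subst_var phi i : subst phi 'X_i = form_val (phi (var i)).
Proof. by rewrite /subst comp_mpolyXU -tnth_nth tnth_mktuple. Qed.

Lemma subst_form phi l : subst phi (form_val l) = form_val (phi l).
Proof.
rewrite [in RHS](linform_expand l) {1}(linform_expand l) !linear_sum.
by apply: eq_bigr => i _; rewrite !linearZ /= subst_var.
Qed.

Lemma subst_comp phi psi p : subst phi (subst psi p) = subst (phi \o psi)%VF p.
Proof.
elim/mpolyind: p => [|c m p _ _ IH]; first by rewrite !raddf0.
rewrite !raddfD /= IH !linearZ /=; congr (_ *: _ + _).
rewrite mpolyXE_id !rmorph_prod /=; apply: eq_bigr => i _.
by rewrite !rmorphXn /= !subst_var subst_form comp_lfunE.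
Qed.

Local Notation "f \in_ideal A" := (in_ideal_of_space A f) (at level 70).

Lemma ideal_form A l : l \in A -> form_val l \in_ideal A.
Proof.
move=> lA; exists [:: (1, form_val l)]; rewrite big_seq1 mul1r; split=> // q.
by rewrite inE => /eqP ->; exists l.
Qed.

Lemma ideal0 A : 0 \in_ideal A.
Proof. by exists [::]; rewrite big_nil. Qed.

Lemma idealD A f g : f \in_ideal A -> g \in_ideal A -> f + g \in_ideal A.
Proof.
move=> [s [sA ->]] [t [tA ->]]; exists (s ++ t); rewrite big_cat; split=> // q.
by rewrite mem_cat => /orP[/sA|/tA].
Qed.

Lemma idealMl A g f : f \in_ideal A -> g * f \in_ideal A.
Proof.
move=> [s [sA ->]]; exists [seq (g * x.1, x.2) | x <- s].
rewrite big_map mulr_sumr; split=> [_ /mapP[x xs ->]|]; first exact: (sA x xs).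
by apply: eq_bigr => i _; rewrite mulrA.
Qed.

Lemma idealB A f g : f \in_ideal A -> g \in_ideal A -> f - g \in_ideal A.
Proof. by move=> fA gA; rewrite -mulN1r; apply/idealD/idealMl. Qed.

Lemma ideal_ind A (K : {mpoly k[n]} -> Prop) :
    K 0 -> (forall f g, K f -> K g -> K (f + g)) ->
    (forall g l, l \in A -> K (g * form_val l)) ->
  forall f, f \in_ideal A -> K f.
Proof.
move=> K0 KD KM f [s [sA ->]]; rewrite big_seq.
by apply: big_ind => // q /sA[l lA ->]; apply: KM.
Qed.

Lemma ideal_mono A B f : (A <= B)%VS -> f \in_ideal A -> f \in_ideal B.
Proof.
move=> AB [s [sA ->]]; exists s; split=> // q /sA[l lA ->].
by exists l => //; apply: (subvP AB).
Qed.

Lemma ideal_span A m (X : m.-tuple (linform k n)) f :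
    (A <= <<X>>)%VS -> f \in_ideal A ->
  exists q : 'I_m -> {mpoly k[n]}, f = \sum_(i < _) q i * form_val X`_i.
Proof.
move=> AX; move: f; apply: ideal_ind => [|f g [p ->] [q ->]|g l /(subvP AX) lX].
- by exists (fun=> 0); rewrite big1 // => i _; rewrite mul0r.
- exists (fun i => p i + q i); rewrite -big_split; apply: eq_bigr => i _.
  by rewrite mulrDl.
- exists (fun i => coord X i l *: g).
  rewrite {1}(coord_span lX) linear_sum mulr_sumr; apply: eq_bigr => i _.
  by rewrite linearZ /= -scalerAr -scalerAl.
Qed.

Lemma ideal_subst phi A B f :
  (phi @: A <= B)%VS -> f \in_ideal A -> subst phi f \in_ideal B.
Proof.
move=> AB; move: f; apply: ideal_ind => [|f g fB gB|g l lA].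
- by rewrite linear0; apply: ideal0.
- by rewrite linearD; apply: idealD.
- rewrite rmorphM /= subst_form; apply/idealMl/ideal_form/(subvP AB).
  exact: memv_img.
Qed.

(** [phi] induces the identity modulo (A), as a ring endomorphism that fixes
    every variable modulo an ideal fixes every polynomial modulo it. *)
Lemma subst_sub_ideal phi A f :
  (forall l, l - phi l \in A) -> f - subst phi f \in_ideal A.
Proof.
move=> phiA.
have mono (a b a' b' : {mpoly k[n]}) :
    a - a' \in_ideal A -> b - b' \in_ideal A -> a * b - a' * b' \in_ideal A.
  move=> aA bA; rewrite -(subrK (a * b') (a * b)) -addrA -mulrBr -mulrBl.
  by apply: idealD; last rewrite mulrC; apply: idealMl.
elim/mpolyind: f => [|c m p _ _ IH].
  by rewrite linear0 subrr; apply: ideal0.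
rewrite linearD opprD addrACA; apply: idealD => //.
rewrite linearZ /= -scalerBr -mul_mpolyC; apply: idealMl.
rewrite mpolyXE_id rmorph_prod.
elim/big_rec2: _ => [|i x y _ IHi]; first by rewrite subrr; apply: ideal0.
apply: (mono) => //; rewrite rmorphXn /=.
elim: (m i) => [|d IHd]; first by rewrite subrr; apply: ideal0.
rewrite !exprS; apply: mono => //.
by rewrite subst_var -[X in X - _]/(form_val (var i)) -linearB; apply: ideal_form.
Qed.

Lemma subst_ideal0 phi A f :
  (forall l, l \in A -> phi l = 0) -> f \in_ideal A -> subst phi f = 0.
Proof.
move=> phi0; move: f; apply: ideal_ind => [|f g f0 g0|g l lA].
- exact: linear0.
- by rewrite linearD /= f0 g0 addr0.
- by rewrite rmorphM /= subst_form phi0 // linear0 mulr0.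
Qed.

Lemma pihomog_mull d e p q :
  p \is d.-homog -> pihomog mdeg (d + e) (p * q) = p * pihomog mdeg e q.
Proof.
move=> hp; elim/mpolyind: q => [|c m q _ _ IH]; first by rewrite !(linear0, mulr0).
rewrite mulrDr !raddfD /= IH mulrDr -scalerAr !linearZ /= -scalerAr.
congr (c *: _ + _).
have hX : 'X_[k, m] \is (mdeg m).-homog by rewrite dhomogX.
rewrite pihomogX /=; case: eqP => [<-|me]; first exact/pihomog_dE/dhomogM.
rewrite mulr0; apply: pihomog_ne0 (dhomogM hp hX).
by rewrite eqn_add2l; apply/eqP.
Qed.

(** The ideal (A) is homogeneous, being generated in degree one.  The degree is a
    successor so that a multiple of a generator projects onto a multiple of it. *)
Lemma ideal_pihomog A d f :
  f \in_ideal A -> pihomog mdeg d.+1 f \in_ideal A.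
Proof.
move: f; apply: ideal_ind => [|f g fA gA|g l lA].
- by rewrite linear0; apply: ideal0.
- by rewrite linearD; apply: idealD.
- rewrite mulrC -add1n pihomog_mull; last exact: dhomog_is_dhomog.
  by rewrite mulrC; apply/idealMl/ideal_form.
Qed.

(** * Dependence on a subspace modulo an ideal *)

(** Modulo (A :&: B), write h as a sum of q_i * x_i with the x_i in a complement
    of A :&: B in A.  A retraction [pi] that fixes the x_i and kills B sends h
    and (A :&: B) to 0, so the sum of the pi(q_i) * x_i vanishes, and each q_i
    may be replaced by q_i - pi(q_i), which lies in (B).  Homogeneity of h then
    allows the remaining coefficients to be cut down to their linear parts. *)
Lemma cubic_ideal_cap A B h :
    h \is 3.-homog -> h \in_ideal A -> h \in_ideal B ->
  exists t : 'I_(\dim (A :\: B)) -> 'I_(\dim B) -> linform k n,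
    h - \sum_(i < _) \sum_(j < _) form_val (vbasis (A :\: B))`_i
          * (form_val (vbasis B)`_j * form_val (t i j)) \in_ideal (A :&: B)%VS.
Proof.
move=> h3 hA hB; set X := vbasis (A :\: B); set Y := vbasis B.
have [pi [piX piB pi_sub]] := retraction_along (capv_diff A B).
have [q hq] : exists q : 'I_(\dim (A :\: B)) -> {mpoly k[n]},
    h - \sum_(i < _) q i * form_val X`_i \in_ideal (A :&: B)%VS.
  move: h hA {h3 hB}; apply: ideal_ind => [|f g [p pf] [q qg]|g l lA].
  - exists (fun=> 0); rewrite big1 ?subr0 => [|i _]; first exact: ideal0.
    by rewrite mul0r.
  - exists (fun i => p i + q i).
    under eq_bigr do rewrite mulrDl.
    by rewrite big_split opprD addrACA; apply: idealD.
  - have : l \in (A :\: B + A :&: B)%VS by rewrite addv_diff_cap.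
    move=> /memv_addP[x xA [y yAB ->]].
    have xX : x \in <<X>>%VS by rewrite (span_basis (vbasisP _)).
    exists (fun i => coord X i x *: g).
    rewrite linearD /= mulrDr {1}(coord_span xX) linear_sum mulr_sumr.
    rewrite addrAC; set d := _ - _; have -> : d = 0.
      apply/eqP; rewrite subr_eq0; apply/eqP/eq_bigr => i _.
      by rewrite linearZ /= -scalerAr -scalerAl.
    by rewrite add0r; apply/idealMl/ideal_form.
have X_fix (i : 'I_(\dim (A :\: B))) : pi X`_i = X`_i.
  by apply/piX/vbasis_mem/mem_nth; rewrite size_tuple.
have qB : subst pi (\sum_(i < _) q i * form_val X`_i) = 0.
  have hAB : subst pi (h - \sum_(i < _) q i * form_val X`_i) = 0.
    apply: subst_ideal0 hq => l; rewrite memv_cap => /andP[_]; exact: piB.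
  by move/eqP: hAB; rewrite linearB /= (subst_ideal0 piB hB) sub0r oppr_eq0 => /eqP.
have q_sub i : exists p : 'I_(\dim B) -> {mpoly k[n]},
    q i - subst pi (q i) = \sum_(j < _) p j * form_val Y`_j.
  apply: ideal_span (subst_sub_ideal (q i) pi_sub).
  by rewrite (span_basis (vbasisP _)).
have [p qp] := choice q_sub.
exists (fun i j => DHomog (pihomogP mdeg 1 (p i j))).
have qE : \sum_(i < _) q i * form_val X`_i
    = \sum_(i < _) form_val X`_i * \sum_(j < _) form_val Y`_j * p i j.
  move: qB; rewrite linear_sum => qB0.
  rewrite -[LHS]subr0 -[X in _ - X]qB0 -sumrB; apply: eq_bigr => i _.
  rewrite rmorphM /= subst_form X_fix -mulrBl qp mulrC; congr (_ * _).
  by apply: eq_bigr => j _; rewrite mulrC.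
have := ideal_pihomog 2 hq.
rewrite pihomogB pihomog_dE // qE; set u := pihomog _ _ _.
suff -> : u = \sum_(i < _) \sum_(j < _)
    form_val X`_i * (form_val Y`_j * pihomog mdeg 1 (p i j)) by [].
rewrite /u (raddf_sum (pihomog mdeg 3)); apply: eq_bigr => i _.
rewrite /= -[3%N]/(1 + 2)%N pihomog_mull; last exact: dhomog_is_dhomog.
rewrite (raddf_sum (pihomog mdeg 2)) mulr_sumr; apply: eq_bigr => j _.
by rewrite /= -[2%N]/(1 + 1)%N pihomog_mull //; exact: dhomog_is_dhomog.
Qed.

(** If f is e + a with e a polynomial in the forms of E and a in (A), where A lies
    in E, then substitutions fixing E move f only within (A); conversely,
    substituting a projection onto E exhibits such an e. *)
Definition depends_mod E A f :=
  forall phi, (forall l, l \in E -> phi l = l) -> f - subst phi f \in_ideal A.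

Lemma depends_mod_ideal A f : f \in_ideal A -> depends_mod A A f.
Proof.
move=> fA phi phiA; apply: idealB => //; apply: ideal_subst fA.
by apply/subvP => _ /memv_imgP[l lA ->]; rewrite phiA.
Qed.

Lemma subst_homog phi d p : p \is d.-homog -> subst phi p \is d.-homog.
Proof.
move=> hp; rewrite (mpolyE p) linear_sum big_seq; apply: rpred_sum => m mp.
rewrite linearZ /= rpredZ // mpolyXE_id rmorph_prod /=.
have <- : mdeg m = d by apply: dhomog_mf hp _ mp.
rewrite mdegE; apply: (big_ind2 (fun p e => p \is e.-homog)) => [||i _].
- exact: dhomog1.
- by move=> *; apply: dhomogM.
- rewrite rmorphXn /= subst_var.
  by have := dhomogMn (m i) (dhomog_is_dhomog (phi (var i))); rewrite mul1n.
Qed.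

(** The difference h between f and its image under the projection [tau] onto
    U = E + B lies in (A) and in (B), and f - h is a polynomial in the forms of U.
    So the only forms to add to U are the linear coefficients that
    [cubic_ideal_cap] provides for h. *)
Lemma depends_mod_cap E A B f :
    f \is 3.-homog -> (A <= E)%VS -> depends_mod E A f -> f \in_ideal B ->
  exists E', [/\ (E + B <= E')%VS, depends_mod E' (A :&: B)%VS f &
    (\dim E' <= \dim (E + B) + \dim (A :\: B) * \dim B)%N].
Proof.
move=> f3 AE fE fB; pose U := (E + B)%VS.
pose tau := projv U; pose h := f - subst tau f.
have tauU l : l \in U -> tau l = l by apply: projv_id.
have hA : h \in_ideal A.
  by apply: fE => l lE; apply/tauU/(subvP (addvSl E B)).
have hB : h \in_ideal B.
  by apply: depends_mod_ideal => // l lB; apply/tauU/(subvP (addvSr E B)).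
have h3 : h \is 3.-homog by rewrite rpredB // subst_homog.
have [t ht] := cubic_ideal_cap h3 hA hB.
pose ts := [seq t i j | i <- enum 'I_(\dim (A :\: B)), j <- enum 'I_(\dim B)].
have tE i j : t i j \in <<ts>>%VS.
  by apply: memv_span; apply: allpairs_f; rewrite mem_enum.
exists (U + <<ts>>)%VS; split; first exact: addvSl.
- move=> phi phiE.
  have phiU l : l \in U -> phi l = l by move=> lU; apply/phiE/(subvP (addvSl _ _)).
  have phit i j : phi (t i j) = t i j by apply/phiE/(subvP (addvSr U _)).
  have tauE : subst phi (subst tau f) = subst tau f.
    rewrite subst_comp; congr (subst _ f); apply/lfunP=> l.
    by rewrite comp_lfunE phiU // memv_proj.
  have -> : f - subst phi f = h - subst phi h.
    by rewrite (raddfB (subst phi) f _) /= tauE opprB addrA subrK.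
  set w := \sum_(i < _) _ in ht.
  have phiw : subst phi w = w.
    rewrite linear_sum; apply: eq_bigr => i _; rewrite linear_sum.
    apply: eq_bigr => j _; rewrite !rmorphM /= !subst_form phit !phiU //.
    - apply/(subvP (addvSr E B))/vbasis_mem/mem_nth; by rewrite size_tuple.
    - apply/(subvP (addvSl E B))/(subvP AE)/(subvP (diffvSl A B)).
      by apply/vbasis_mem/mem_nth; rewrite size_tuple.
  have -> : h - subst phi h = (h - w) - subst phi (h - w).
    by rewrite (raddfB (subst phi) h w) /= phiw opprB addrA subrK.
  apply: depends_mod_ideal ht _ _ => l.
  rewrite memv_cap => /andP[_ lB]; exact/phiU/(subvP (addvSr E B)).
- apply: leq_trans (dimv_add_leqif _ _) _; rewrite leq_add2l.
  apply: leq_trans (dim_span _) _.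
  by rewrite size_allpairs !size_enum_ord.
Qed.

Lemma slice_rank_le_dim (f : dhomog n k 3) P :
  in_ideal_of_space P (f : {mpoly k[n]}) -> (slice_rank f <= \dim P)%N.
Proof.
move=> fP; rewrite /slice_rank; case: ex_minnP => r _; apply; apply/asboolP.
have PX : (P <= <<vbasis P>>)%VS by rewrite (span_basis (vbasisP P)).
have [q fq] := ideal_span PX fP.
exists (fun i => (vbasis P)`_i).
exists [seq (q i, form_val (vbasis P)`_i) | i <- enum 'I_(\dim P)].
rewrite big_map big_enum; split=> // _ /mapP[i _ ->]; by exists i.
Qed.

(** A retraction [pi] that fixes E and kills some p in P outside E changes f by
    an element of (A), and A = pi(A) lies in pi(P).  Hence f lies in the ideal of
    pi(P), whose dimension is below the slice rank. *)
Lemma minimal_space_sub (f : dhomog n k 3) E A P :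
    (A <= E)%VS -> depends_mod E A (f : {mpoly k[n]}) ->
    minimal_space f P -> (A <= P)%VS ->
  (P <= E)%VS.
Proof.
move=> AE fE [dimP fP] AP; apply/subvP => p pP; apply: contraT => pE.
have p0 : p != 0 by apply: contraNneq pE => ->; apply: mem0v.
have Ep0 : (E :&: <[p]> = 0)%VS.
  apply/eqP; rewrite -subv0; apply/subvP=> l; rewrite memv_cap memv0.
  case/andP=> lE /vlineP[c lc]; rewrite lc; apply: contraNT pE => cp0.
  have c0 : c != 0 by apply: contraNneq cp0 => ->; rewrite scale0r.
  by have := memvZ c^-1 lE; rewrite lc scalerA mulVf // scale1r.
have [pi [piE pip _]] := retraction_along Ep0.
have AQ : (A <= pi @: P)%VS.
  apply/subvP => l lA; rewrite -(piE l (subvP AE l lA)).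
  exact/memv_img/(subvP AP).
have fQ : in_ideal_of_space (pi @: P) (f : {mpoly k[n]}).
  rewrite -(subrK (subst pi f) (f : {mpoly k[n]})); apply: idealD.
    exact: ideal_mono AQ (fE pi piE).
  exact: ideal_subst fP.
have := slice_rank_le_dim fQ; rewrite -dimP leqNgt -(limg_ker_dim pi P).
rewrite -[X in (X < _)%N]add0n ltn_add2r lt0n dimv_eq0 => /negPn /eqP kP.
have : p \in (P :&: lker pi)%VS by rewrite memv_cap pP memv_ker pip ?memv_line /=.
by rewrite kP memv0 (negPf p0).
Qed.
End Substitution.

(** * Counting dimensions *)

Section Bound.
Variables (k : fieldType) (n : nat) (f : dhomog n k 3).
Local Notation r := (slice_rank f).

(** Induction along [s], starting from P.  Each member Q adds at most r - c
    dimensions because E already contains P :&: Q, and it adds r more for every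
    dimension lost by the running intersection. *)
Lemma depends_mod_bigcap P c (s : seq {vspace linform k n}) :
    minimal_space f P ->
    (forall Q, Q \in s -> minimal_space f Q /\ (c <= \dim (P :&: Q))%N) ->
  exists E, [/\ (P <= E)%VS,
    depends_mod E (P :&: \bigcap_(Q <- s) Q)%VS (f : {mpoly k[n]}) &
    (\dim E + size s * c + \dim (P :&: \bigcap_(Q <- s) Q) * r
      <= r + size s * r + r * r)%N].
Proof.
move=> [dimP fP]; elim/last_ind: s => [|s Q IH] sP.
  rewrite big_nil capvf; exists P; split=> //; first exact: depends_mod_ideal.
  by rewrite /= dimP; lia.
have [|E [PE fE le]] := IH.
  by move=> R Rs; apply: sP; rewrite mem_rcons inE Rs orbT.
have [[dimQ fQ] cQ] : minimal_space f Q /\ (c <= \dim (P :&: Q))%N.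
  by apply: sP; rewrite mem_rcons mem_head.
rewrite big_rcons /= capvA.
set C := (P :&: _)%VS in fE le *.
have CE : (C <= E)%VS by apply: subv_trans PE; apply: capvSl.
have [E' [EQE' fE' le']] := depends_mod_cap (dhomog_is_dhomog f) CE fE fQ.
exists E'; split=> //.
- exact: subv_trans (subv_trans PE (addvSl E Q)) EQE'.
- have := dimv_sum_cap E Q.
  have := dimv_cap_compl C Q.
  have : (\dim (P :&: Q) <= \dim (E :&: Q))%N by rewrite dimvS ?capvS.
  rewrite size_rcons; move: le le' cQ; rewrite dimQ.
  nia.
Qed.

(** Take [s] shortest among the families whose intersection with P has the
    least possible dimension.  Minimality of the dimension forces this
    intersection into every minimal space.  For Q in [s], the other members can
    be thinned out, keeping their intersection with P :&: Q, to at most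
    dim (P :&: Q) of them; together with Q they form a family of the same kind,
    which cannot be shorter than [s]. *)
Lemma minimal_spaces_cap P : minimal_space f P ->
  exists s : seq {vspace linform k n},
    [/\ forall Q, Q \in s -> minimal_space f Q,
      forall Q, Q \in s -> (size s <= (\dim (P :&: Q)).+1)%N &
      forall Q, minimal_space f Q -> (P :&: \bigcap_(R <- s) R <= Q)%VS].
Proof.
move=> Pmin.
pose fam (s : seq {vspace linform k n}) := forall Q, Q \in s -> minimal_space f Q.
pose capP s := (P :&: \bigcap_(R <- s) R)%VS.
have exd : exists d, `[< exists2 s, fam s & \dim (capP s) = d >].
  by exists (\dim (capP [::])); apply/asboolP; exists [::].
case: (ex_minnP exd) => d /asboolP[s0 s0f ds0] dmin.
have exm : exists m, `[< exists s, [/\ fam s, \dim (capP s) = d & size s = m] >].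
  by exists (size s0); apply/asboolP; exists s0.
case: (ex_minnP exm) => m /asboolP[s [sf ds sm]] mmin.
exists s; split=> // Q Qs; last first.
  have dle : (d <= \dim (capP (Q :: s)))%N.
    apply: dmin; apply/asboolP; exists (Q :: s) => //.
    by move=> R; rewrite inE => /orP[/eqP ->|/sf].
  have sub : (capP (Q :: s) <= capP s)%VS by rewrite /capP big_cons capvS ?capvSr.
  rewrite -/(capP s); have /eqP <- : capP (Q :: s) == capP s by rewrite eqEdim sub ds.
  by rewrite /capP big_cons capvA (capvC P) -capvA capvSl.
have [s' [s's s'E le]] := shorten_cap (P :&: Q)%VS (rem Q s).
suff : (m <= size (Q :: s'))%N by rewrite sm => /leq_trans; apply.
apply: mmin; apply/asboolP; exists (Q :: s'); split=> //.
  by move=> R; rewrite inE => /orP[/eqP ->|/s's/mem_rem]; apply: sf.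
rewrite -ds /capP; congr (\dim _).
by rewrite (perm_big _ (perm_to_rem Qs)) !big_cons !capvA.
Qed.
End Bound.

Theorem theoremA (k : fieldType) (n : nat) (f : dhomog n k 3) (r : nat)
    (hr : r = slice_rank f) :
  (\dim (Lf f))%:R <= r%:R ^+ 2 + (r%:R + 1) ^+ 2 / 4 + r%:R :> rat.
Proof.
suff le : (4 * \dim (Lf f) <= 4 * r ^ 2 + (r + 1) ^ 2 + 4 * r)%N.
  have : ((4 * \dim (Lf f))%:R <= (4 * r ^ 2 + (r + 1) ^ 2 + 4 * r)%:R :> rat).
    by rewrite ler_nat.
  rewrite !(natrD, natrM, natrX); lra.
have Lf_mem v : v \in Lf f <-> in_sum_of_spaces (minimal_space f) v.
  by rewrite /Lf /sum_of_spaces; case: cid.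
have [[P Pmin]|noP] := pselect (exists P, minimal_space f P); last first.
  suff -> : Lf f = 0%VS by rewrite dimv0; lia.
  apply/eqP; rewrite -subv0; apply/subvP => v /Lf_mem[s [sP ->]].
  rewrite big_seq; apply: rpred_sum => x /sP[P Pmin _].
  by case: noP; exists P.
have [s [sf ssize smin]] := minimal_spaces_cap Pmin.
have [|E [PE fE le]] := @depends_mod_bigcap _ _ f P (size s).-1 s Pmin.
  by move=> Q Qs; split; [exact: sf | have := ssize Q Qs; lia].
have LE : (Lf f <= E)%VS.
  apply/subvP => v /Lf_mem[t [tP ->]].
  rewrite big_seq; apply: rpred_sum => x /tP[Q Qmin xQ].
  apply: (subvP _ x xQ); apply: minimal_space_sub fE Qmin (smin Q Qmin).
  exact: subv_trans (capvSl _ _) PE.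
have {LE} := dimvS LE; move: le; rewrite hr.
move: (\dim E) (\dim (Lf f)) (size s) (slice_rank f) (\dim (P :&: _)) => e L m q c.
(* the difference of the two sides is (q + 1 - 2 m)^2 *)
have agm : (4 * (m * q) <= (q + 1) ^ 2 + 4 * (m * m.-1))%N.
  by rewrite -!mulnn; case: m => [|m] /=; [lia | have [] := leqP q (2 * m + 1); nia].
rewrite -!mulnn in agm *; nia.
Qed.
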